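(* For every $q>1$ and $\delta\in(0,1)$ there is $c(q,\delta)>0$ such that the following holds. If $1\le k_1<k_2<\cdots$ is a sequence of integers with $k_{j+1}/k_j\ge q$ for all $j$, then for every positive integer $N$ and every $n\le(1-\delta)N$, $$ d_n^{\mathbb C}\bigl(\{e^{2\pi i k_jx}\}_{j=1}^N,L_1(\mathbb T)\bigr)\ \ge\ c(q,\delta). $$
   Context: $\mathbb T=\mathbb R/\mathbb Z$ with normalized Lebesgue measure. The complex Kolmogorov width is $$ d_n^{\mathbb C}(\{f_1,\dots,f_N\},X):=\inf_{\dim_{\mathbb C} V\le n}\ \max_{1\le k\le N}\operatorname{dist}_{X}(f_k,V),$$ the infimum being over complex linear subspaces $V\subset X$ of dimension at most $n$. *)

(* Defs.v *)
From HB Require Import structures.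
From mathcomp Require Import all_boot all_order all_algebra.
From mathcomp Require Import complex.
From mathcomp Require Import all_classical all_reals all_analysis.

Set Implicit Arguments.
Unset Strict Implicit.
Unset Printing Implicit Defensive.

Import Order.TTheory GRing.Theory Num.Theory.
Import numFieldNormedType.Exports.

Local Open Scope classical_set_scope.
Local Open Scope ring_scope.
Local Open Scope complex_scope.

Section KolmogorovWidth.
Context {R : realType} {K : fieldType} {E : lmodType K}.

Definition span_of n (b : 'I_n -> E) : set E :=
  [set \sum_(i < n) a i *: b i | a in [set: 'I_n -> K]].

(* The vectors [b i] need not be independent, hence dimension at most [n]. *)
Definition subspaces_dim_le (n : nat) : set (set E) :=
  [set span_of b | b in [set: 'I_n -> E]].

Variable nrm : E -> R.

Definition dist_to (f : E) (V : set E) : \bar R :=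
  ereal_inf [set (nrm (f - v))%:E | v in V].

(* Taken in the extended reals, where infima and maxima need no default value:
   for N > 0 all the quantities involved are finite. *)
Definition kolmogorov_width (n N : nat) (f : 'I_N -> E) : \bar R :=
  ereal_inf [set \big[maxe/-oo%E]_(k < N) dist_to (f k) V
            | V in subspaces_dim_le n].

End KolmogorovWidth.

Section L1Torus.
Context {R : realType}.

Local Notation mu := (@lebesgue_measure R).

(* Functions on R/Z are 1-periodic functions on R, and normalized Lebesgue
   measure on R/Z is Lebesgue measure on the fundamental domain [0, 1]. *)
Definition is_L1T (f : R -> R[i]) : Prop :=
  [/\ periodic f 1,
      mu.-integrable `[0, 1] (fun x => (complex.Re (f x))%:E) &
      mu.-integrable `[0, 1] (fun x => (complex.Im (f x))%:E)].

Definition L1T_pred : {pred (R -> R[i])} := mem [set f | is_L1T f].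

Lemma L1T_submod_closed : submod_closed L1T_pred.
Proof.
have ReM (a z : R[i]) : complex.Re (a * z) =
    complex.Re a * complex.Re z - complex.Im a * complex.Im z.
  by case: a z => [? ?] [? ?].
have ImM (a z : R[i]) : complex.Im (a * z) =
    complex.Re a * complex.Im z + complex.Im a * complex.Re z.
  by case: a z => [? ?] [? ?].
split.
  rewrite inE; split => //=.
  - exact: (@integrable0 _ _ _ mu).
  - exact: (@integrable0 _ _ _ mu).
move=> a f g; rewrite !inE => -[pf rf jf] [pg rg jg].
have mI : measurable (`[0, 1] : set (measurableTypeR R)) by [].
split => [x||].
- by rewrite /= /GRing.add/= /GRing.scale/= pf pg.
- have := integrableD mI (integrableB mI (integrableZl mI (complex.Re a) rf)
    (integrableZl mI (complex.Im a) jf)) rg.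
  apply: eq_integrable mI _ _ _ => x _ /=.
  rewrite -!EFinM -EFinB -EFinD -ReM.
  by rewrite -raddfD.
- have := integrableD mI (integrableD mI (integrableZl mI (complex.Re a) jf)
    (integrableZl mI (complex.Im a) rf)) jg.
  apply: eq_integrable mI _ _ _ => x _ /=.
  rewrite -!EFinM -!EFinD -ImM.
  by rewrite -raddfD.
Qed.

HB.instance Definition _ :=
  GRing.isSubmodClosed.Build R[i] (R -> R[i]) L1T_pred L1T_submod_closed.

End L1Torus.

(* As for the library's [LfunType], functions equal almost everywhere are not
   identified, so that [L1norm] is only a seminorm. Kolmogorov widths are
   unaffected: spans of [n] functions map onto spans of [n] classes, and the
   distances depend only on the classes. *)
Record L1T (R : realType) := MkL1T {
  L1T_fun :> R -> R[i];
  L1T_funP : L1T_fun \in L1T_pred }.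

HB.instance Definition _ (R : realType) := [isSub for @L1T_fun R].
HB.instance Definition _ (R : realType) := [Choice of L1T R by <:].
HB.instance Definition _ (R : realType) := [SubChoice_isSubLmodule of L1T R by <:].

Section Characters.
Context {R : realType}.

(* The norm of [R[i]] is valued in [R[i]]; [normc] is the same with values in [R]. *)
Definition L1norm (f : L1T R) : R :=
  (\int[lebesgue_measure]_(x in `[0%R, 1%R]) ComplexField.Normc.normc (f x))%R.

(* x |-> exp (2 pi i m x), through Euler's formula *)
Definition expT_fun (m : nat) (x : R) : R[i] :=
  cos (2 * pi * m%:R * x) +i* sin (2 * pi * m%:R * x).

Lemma expT_funP (m : nat) : expT_fun m \in L1T_pred.
Proof.
have cintegrable (h : R -> R) : continuous h ->
    (@lebesgue_measure R).-integrable `[0, 1] (fun x => (h x)%:E).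
  move=> ch; apply: continuous_compact_integrable.
    exact: segment_compact.
  exact: continuous_subspaceT.
have clin : continuous (fun x : R => 2 * pi * m%:R * x).
  by move=> x; apply: cvgM; [exact: cvg_cst|exact: cvg_id].
rewrite inE; split => /=.
- move=> x; rewrite /expT_fun.
  have -> : 2 * pi * m%:R * (x + 1) = 2 * pi * m%:R * x + (pi *+ 2) *+ m :> R.
    by rewrite mulrDr mulr1 mulr_natr (mulr_natl pi 2).
  elim: m {clin} (2 * pi * m%:R * x) => [|n IHn] y; first by rewrite mulr0n addr0.
  by rewrite mulrSr addrA cosD2pi sinD2pi.
- apply: cintegrable => x.
  by apply: continuous_comp; [exact: clin|exact: continuous_cos].
- apply: cintegrable => x.
  by apply: continuous_comp; [exact: clin|exact: continuous_sin].
Qed.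

Definition expT (m : nat) : L1T R := MkL1T (expT_funP m).

End Characters.

(* Main.v *)
(* Let g_i = sum_l a_il b_l (i < N) be within c of e_i = exp(2 pi i k_i x) in L1.
   For independent z_i in a grid of the square [-1,1]^2, the Riesz product with
   factors 1 + Re(conj(z_i) e_i)/2 is positive with mean 1 over the grid at every
   point x. Taking one such product for each residue class of the indices modulo
   a large r, where the frequencies are very sparse, and adding them up gives a
   kernel mu_z whose integral against e_i is z_i/4 for all i < N. Its integral
   against g_i is sum_l a_il beta_l(z). Hence, on average over z, the vector z is
   within O(r c N) in l1 of the fixed subspace {(sum_l a_il beta_l)_i}, of
   dimension n <= (1 - delta) N. A volume argument, carried out by counting points of a
   fine lattice in that subspace, shows that at most C^N K^(2n) of the K^(2N)
   grid points can be that close, which is absurd when K^delta is large and c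
   is small compared to 1/(r K). *)

Require Import Defs.
From mathcomp Require Import all_boot all_order all_algebra.
From mathcomp Require Import complex.
From mathcomp Require Import all_classical all_reals all_analysis.
From mathcomp Require Import measurable_realfun.
From mathcomp Require Import zify ring lra.

Set Implicit Arguments.
Unset Strict Implicit.
Unset Printing Implicit Defensive.

Import Order.TTheory GRing.Theory Num.Theory.
Import numFieldNormedType.Exports.
Local Open Scope ring_scope.

(** * Grid points close to a subspace in l1 norm *)

Lemma card_le_fibers (X Y : finType) (A : {set X}) (B : {set Y}) (f : X -> Y)
    (m : nat) :
  (forall x, x \in A -> f x \in B) ->
  (forall y, y \in B -> #|[set x in A | f x == y]| <= m)%N ->
  (#|A| <= m * #|B|)%N.
Proof.
move=> fAB fib; rewrite -sum1_card (partition_big f (mem B)) //=.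
rewrite mulnC -sum_nat_const leq_sum // => y yB.
rewrite (leq_trans _ (fib y yB)) // -sum1_card leq_eqVlt; apply/orP; left.
by apply/eqP; apply: eq_bigl => x; rewrite inE.
Qed.

(** Two geometric series meet at [c]; the partial sums stay below the next weight up to [c], and
    below [4 - 2 * 2^-k] after [k] more terms. *)
Lemma sum_half_distn (c K : nat) :
  \sum_(v < K) (2^-1 : rat) ^+ `|v - c|%N <= 4.
Proof.
pose S K := \sum_(v < K) (2^-1 : rat) ^+ `|v - c|%N.
have half_ge0 k : 0 <= (2^-1 : rat) ^+ k by rewrite exprn_ge0.
have half_le1 k : (2^-1 : rat) ^+ k <= 1 by rewrite exprn_ile1.
have below : forall k, (k <= c)%N -> S k <= 2^-1 ^+ (c - k).
  elim=> [|k IHk] kc; first by rewrite /S big_ord0.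
  rewrite /S big_ord_recr /= -/(S k).
  have -> : `|k - c|%N = (c - k.+1).+1 by lia.
  have := IHk (ltnW kc); have -> : (c - k = (c - k.+1).+1)%N by lia.
  rewrite exprS; lra.
have above : forall k, S (c + k)%N <= 4 - 2 * 2^-1 ^+ k.
  elim=> [|k IHk].
    by rewrite addn0 (le_trans (below _ (leqnn c))) // subnn expr0; lra.
  rewrite addnS /S big_ord_recr /= -/(S (c + k)%N).
  have -> : `|(c + k)%N - c|%N = k by lia.
  rewrite exprS; move: IHk; lra.
case: (leqP K c) => [/below SK|/ltnW cK].
  by apply: (le_trans SK); rewrite (le_trans (half_le1 _)).
rewrite -/(S K) -(subnKC cK) (le_trans (above _)) //.
by have := half_ge0 (K - c)%N; lra.
Qed.

(** Fix [z0] in [A]. Every [z] in [A] has weight [2 ^ M * \prod_i 2 ^ - |z i - z0 i| >= 1], and the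
    sum of the weights over all [z] factors over the coordinates, each giving at most 4. *)
Lemma card_l1_diameter (I : finType) (K M : nat) (A : {set {ffun I -> 'I_K}}) :
  (forall z z', z \in A -> z' \in A -> \sum_i `|z i - z' i|%N <= M)%N ->
  (#|A| <= 2 ^ (M + 2 * #|I|))%N.
Proof.
move=> diamA; have [->|[z0 z0A]] := set_0Vmem A; first by rewrite cards0.
rewrite -(ler_nat rat) natrX exprD exprM -sum1_card natr_sum.
have half_ge0 k : 0 <= (2^-1 : rat) ^+ k by rewrite exprn_ge0.
apply: (@le_trans _ _ (\sum_(z : {ffun I -> 'I_K})
    2 ^+ M * \prod_i 2^-1 ^+ `|z i - z0 i|%N)).
  rewrite big_mkcond; apply: ler_sum => z _; case: ifP => [zA|_]; last first.
    by rewrite mulr_ge0 ?exprn_ge0 ?prodr_ge0.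
  rewrite prodrXr; have le := diamA z z0 zA z0A.
  rewrite -(subnK le) exprD -mulrA -exprMn divff // expr1n mulr1.
  by rewrite exprn_ege1.
rewrite -mulr_sumr ler_wpM2l ?exprn_ge0 //.
rewrite -(bigA_distr_bigA (fun i (v : 'I_K) => (2^-1 : rat) ^+ `|v - z0 i|%N)).
have -> : (2 ^+ 2 : rat) ^+ #|I| = \prod_(i : I) 4 by rewrite prodr_const.
by apply: ler_prod => i _; rewrite sum_half_distn sumr_ge0.
Qed.

(** * Lattice points with bounded integer coordinates, and a packing bound *)

Section LatticeCoding.
Context {L : finType}.

Definition box_dec D (u : {ffun L -> 'I_D.*2.+1}) (l : L) : int :=
  (u l)%:Z - D%:Z.

Definition box_enc D (v : L -> int) : {ffun L -> 'I_D.*2.+1} :=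
  [ffun l => inord `|v l + D%:Z|].

Lemma box_encK D (v : L -> int) :
  (forall l, `|v l| <= D%:Z) -> box_dec (box_enc D v) =1 v.
Proof.
move=> vD l; rewrite /box_dec ffunE inordK; have := vD l; lia.
Qed.

Lemma box_dec_inj D (u u' : {ffun L -> 'I_D.*2.+1}) :
  box_dec u =1 box_dec u' -> u = u'.
Proof.
move=> uu'; apply/ffunP => l; apply/val_inj => /=.
by have := uu' l; rewrite /box_dec; lia.
Qed.

Lemma box_dec_le D (u : {ffun L -> 'I_D.*2.+1}) l : `|box_dec u l| <= D%:Z.
Proof. by rewrite /box_dec; have := ltn_ord (u l); lia. Qed.

End LatticeCoding.

Section LatticePoints.
Context {R : realFieldType} {I L : finType}.
Variables (B : L -> I -> R) (tau : R).

(** The lattice of mesh [tau] spanned by the vectors [B l]. Balls are sets of coordinate vectors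
    rather than of points, so linearly dependent [B l] cause no trouble in counting. *)
Definition lattice_pt (v : L -> int) (i : I) : R :=
  tau * \sum_l (v l)%:~R * B l i.

Definition lattice_ball D (r : R) : {set {ffun L -> 'I_D.*2.+1}} :=
  [set u | \sum_i `|lattice_pt (box_dec u) i| <= r].

Lemma eq_lattice_pt v v' : v =1 v' -> lattice_pt v =1 lattice_pt v'.
Proof. by move=> vv' i; congr (_ * _); apply: eq_bigr => l _; rewrite vv'. Qed.

Lemma lattice_ptD v v' i :
  lattice_pt (fun l => v l + v' l) i = lattice_pt v i + lattice_pt v' i.
Proof.
rewrite /lattice_pt -mulrDr -big_split; congr (_ * _).
by apply: eq_bigr => l _ /=; rewrite intrD mulrDl.
Qed.

Lemma lattice_ptZ (m : nat) v i :
  lattice_pt (fun l => m%:Z * v l) i = m%:R * lattice_pt v i.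
Proof.
rewrite /lattice_pt mulrCA; congr (_ * _); rewrite mulr_sumr.
by apply: eq_bigr => l _ /=; rewrite intrM mulrA.
Qed.

(* Two lattice points in the same residue class modulo K differ by K times a
   lattice point, which lies in a ball K/2 times smaller. *)
Lemma card_lattice_ball D D' K (r r' : R) :
  (0 < K)%N -> (D'.*2 <= K * D)%N -> 2 * r' <= K%:R * r ->
  (#|lattice_ball D' r'| <= K ^ #|L| * #|lattice_ball D r|)%N.
Proof.
move=> K0 DD' rr'.
pose res (u : {ffun L -> 'I_D'.*2.+1}) : {ffun L -> 'I_K} :=
  [ffun l => Ordinal (ltn_pmod (u l) K0)].
have -> : (K ^ #|L| = #|[set: {ffun L -> 'I_K}]|)%N.
  by rewrite cardsT card_ffun card_ord.
rewrite mulnC; apply: (@card_le_fibers _ _ _ _ res) => [u _|y _].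
  by rewrite inE.
set F := [set x in _ | _]; have [->|[u0 u0F]] := set_0Vmem F.
  by rewrite cards0.
pose quo (u : {ffun L -> 'I_D'.*2.+1}) l : int :=
  divz (box_dec u l - box_dec u0 l) K.
have quoK u l : u \in F -> K%:Z * quo u l = box_dec u l - box_dec u0 l.
  move: u0F; rewrite !inE => /andP[_ /eqP <-] /andP[_ /eqP /ffunP/(_ l)].
  rewrite !ffunE => /(congr1 val)/= uu0.
  rewrite /quo mulrC divzK // /box_dec opprB addrA subrK.
  by rewrite -eqz_mod_dvd !modz_nat uu0.
have quoD u l : u \in F -> `|quo u l| <= D%:Z.
  move=> uF; have := quoK u l uF.
  have := box_dec_le u l; have := box_dec_le u0 l; move: (quo u l) => w.
  move=> ? ? /(congr1 Num.norm); rewrite normrM => E.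
  have : K%:Z * `|w| <= K%:Z * D%:Z by move: E; lia.
  by rewrite ler_pM2l.
rewrite -(card_in_imset (f := fun u => box_enc D (quo u))); last first.
  move=> u u' uF u'F /(congr1 (@box_dec _ _)) E; apply: box_dec_inj => l.
  have /(congr1 (fun g => g l)) := E.
  rewrite !box_encK => // [El||]; try by move=> ?; apply: quoD.
  by apply: (addIr (- box_dec u0 l)); rewrite -!quoK ?El.
apply/subset_leq_card/fintype.subsetP => _ /imsetP[u uF ->].
have K0R : 0 < K%:R :> R by rewrite ltr0n.
rewrite inE -(ler_pM2l K0R); apply: le_trans rr'; rewrite mulr_sumr.
have -> : 2 * r' = r' + r' by ring.
move: (uF) (u0F); rewrite !inE => /andP[ur _] /andP[u0r _].
apply: le_trans (lerD ur u0r); rewrite -big_split /=; apply: ler_sum => i _.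
rewrite (eq_lattice_pt (box_encK _)); last by move=> l; apply: quoD.
rewrite -[X in X * _]ger0_norm ?ler0n // -normrM -lattice_ptZ.
have E : box_dec u =1 (fun l => (K%:Z * quo u l) + box_dec u0 l).
  by move=> l; rewrite quoK // subrK.
rewrite (eq_lattice_pt E) (lattice_ptD (fun l => K%:Z * quo u l) (box_dec u0)).
set b := lattice_pt (box_dec u0) i; move: (lattice_pt _ i) => a.
by rewrite -[X in `|X| <= _](addrK b) ler_normB.
Qed.

(* Packing: translates of a ball of lattice points by nearby lattice points of
   the elements of A overlap boundedly and stay in a ball of radius about K |I|. *)
Lemma card_near_lattice K (A : {set {ffun I -> 'I_K}}) (c : R)
    (u : {ffun I -> 'I_K} -> L -> int) D :
  (4 <= K)%N -> 0 <= c <= K%:R - 1 ->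
  (forall z l, `|u z l| <= D%:Z) ->
  (forall z, z \in A ->
     \sum_i `|(z i)%:R - c - lattice_pt (u z) i| <= #|I|%:R) ->
  (#|A| <= 2 ^ (12 * #|I|) * K ^ #|L|)%N.
Proof.
move=> K4 cK uD uA; set N := #|I|.
pose S := lattice_ball D (4 * N%:R).
have S0 : (0 < #|S|)%N.
  apply/card_gt0P; exists (box_enc D (fun=> 0)); rewrite inE.
  rewrite big1 ?mulr_ge0 ?ler0n // => i _.
  rewrite (eq_lattice_pt (box_encK _)) ?normr0 // /lattice_pt.
  by rewrite big1 ?mulr0 ?normr0 // => l _; rewrite mul0r.
rewrite -(leq_pmul2r S0) -mulnA.
have K4R : 4 <= K%:R :> R by rewrite ler_nat.
have N0 : 0 <= N%:R :> R by rewrite ler0n.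
(* The translates lie in the ball of radius [(K - 1) * N + N + 4 * N]: for [z - c], for its
   approximation and for [S]. Residues modulo [K] compare this ball with [S]; [4 <= K] gives both
   [4 * D <= K * D] and [2 * (K + 4) <= 4 * K]. *)
apply: (@leq_trans (2 ^ (12 * N) *
    #|lattice_ball D.*2 ((K%:R + 4) * N%:R)|)%N); last first.
  rewrite leq_mul2l card_lattice_ball ?orbT //; first by lia.
    by rewrite -!mul2n mulnA leq_mul2r -[(2 * 2)%N]/4%N K4 orbT.
  rewrite !mulrA ler_wpM2r //; lra.
rewrite -cardsX.
pose f (p : {ffun I -> 'I_K} * {ffun L -> 'I_D.*2.+1}) :=
  box_enc D.*2 (fun l => u p.1 l + box_dec p.2 l).
have fE p : box_dec (f p) =1 (fun l => u p.1 l + box_dec p.2 l).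
  apply: box_encK => l; apply: le_trans (ler_normD _ _) _.
  by have := uD p.1 l; have := box_dec_le p.2 l; lia.
apply: (@card_le_fibers _ _ _ _ f) => [[z v]|y _].
  rewrite !inE /= => /andP[/uA uz vS].
  have zc : \sum_i `|(z i)%:R - c| <= (K%:R - 1) * N%:R.
    rewrite mulr_natr -sumr_const; apply: ler_sum => i _.
    have := ltn_ord (z i); rewrite -(ler_nat R) -natr1 => ?.
    have : 0 <= (z i)%:R :> R by rewrite ler0n.
    case/andP: cK => *; rewrite ler_norml; lra.
  have -> : (K%:R + 4) * N%:R = (K%:R - 1) * N%:R + N%:R + 4 * N%:R :> R.
    by ring.
  apply: le_trans (lerD (lerD zc uz) vS); rewrite -!big_split /=.
  apply: ler_sum => i _; rewrite (eq_lattice_pt (fE _)) (lattice_ptD (u z) (box_dec v)).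
  apply: le_trans (ler_normD _ _) _; rewrite lerD2r.
  by rewrite -[X in `|X|](subKr ((z i)%:R - c)) ler_normB.
(* In a fibre the sum [u z + v] is fixed, so [z] determines [v] and it is enough to count the
   [z]. *)
rewrite -(card_in_imset (f := fst)); last first.
  move=> [z v] [z' v']; rewrite !inE /= => /andP[_ /eqP <-] /andP[_ /eqP E] zz'.
  congr (_, _); rewrite ?zz' //; apply: box_dec_inj => l.
  have := congr1 (fun g => box_dec g l) E; rewrite !fE /= zz'.
  by move/addrI.
(* The [z] of one fibre have l1 diameter at most [10 * N]: [N] for each of two approximations and
   [4 * N] for each of two vectors of [S]. The other [2 * N] comes from [card_l1_diameter]. *)
have -> : (12 * N = 10 * N + 2 * N)%N by rewrite -mulnDl.
apply: card_l1_diameter => _ _ /imsetP[[z v] H ->] /imsetP[[z' v'] H' ->] /=.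
move: H H'; rewrite !inE /= => /andP[/andP[/uA uz vS] /eqP <-].
move=> /andP[/andP[/uA uz' vS'] /eqP E].
rewrite -(ler_nat R) natr_sum natrM.
have -> : 10 * N%:R = N%:R + N%:R + (4 * N%:R + 4 * N%:R) :> R by ring.
apply: le_trans (lerD (lerD uz uz') (lerD vS vS')).
rewrite -!big_split /=; apply: ler_sum => i _.
have := eq_lattice_pt (fE (z, v)) i.
rewrite (lattice_ptD (u z) (box_dec v)) -E (eq_lattice_pt (fE (z', v'))).
rewrite (lattice_ptD (u z') (box_dec v')) => Ei.
rewrite natr_absz intr_norm intrB /= -!pmulrn.
move: (lattice_pt (u z) i) (lattice_pt (u z') i) Ei => a a'.
move: (lattice_pt (box_dec v) i) (lattice_pt (box_dec v') i) => b b' Ei.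
have -> : (z i)%:R - (z' i)%:R = ((z i)%:R - c - a) - ((z' i)%:R - c - a')
    + (b' - b) :> R by lra.
apply: le_trans (ler_normD _ _) _.
by rewrite lerD ?ler_normB // [leRHS]addrC ler_normB.
Qed.
End LatticePoints.

(** Real coefficients are rounded down to multiples of a mesh [tau] so fine that rounding costs at
    most half of the budget [#|I|]; then the lattice count applies. *)
Lemma card_near_subspace (R : realType) (I L : finType) (B : L -> I -> R)
    (K : nat) (A : {set {ffun I -> 'I_K}}) (c : R) :
  (0 < #|I|)%N -> (4 <= K)%N -> 0 <= c <= K%:R - 1 ->
  (forall z, z \in A -> exists al : L -> R,
     \sum_i `|(z i)%:R - c - \sum_l al l * B l i| <= #|I|%:R / 2) ->
  (#|A| <= 2 ^ (12 * #|I|) * K ^ #|L|)%N.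
Proof.
move=> I0 K4 cK nearA.
have /choice[al alP] (z : {ffun I -> 'I_K}) : exists al : L -> R, z \in A ->
    \sum_i `|(z i)%:R - c - \sum_l al l * B l i| <= #|I|%:R / 2.
  have [/nearA[al alP]|_] := boolP (z \in A); first by exists al.
  by exists (fun=> 0).
(* Each coefficient moves by at most [tau], so [tau * s] bounds the total rounding error; this
   choice makes it at most [1 / 2]. *)
pose s := \sum_i \sum_l `|B l i|; pose tau := (2 * s + 1)^-1.
have s0 : 0 <= s by apply: sumr_ge0 => i _; apply: sumr_ge0.
have tau0 : 0 < tau by rewrite invr_gt0; lra.
have taus : tau * s <= #|I|%:R / 2.
  have : 1 <= #|I|%:R :> R by rewrite ler1n.
  suff : tau * s <= 2^-1 by lra.
  by rewrite mulrC ler_pdivrMr; lra.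
pose u z l : int := Num.floor (al z l / tau).
(* Any box containing all the [u z] serves, as the bound is free of its size. *)
apply: (@card_near_lattice _ _ _ B tau K A c u
  (\sum_z \sum_l `|u z l|%N)%N K4 cK).
  move=> z l; rewrite -abszE lez_nat (bigD1 z) //= (bigD1 l) //=.
  by rewrite -addnA leq_addr.
move=> z /alP zA; have -> : #|I|%:R = #|I|%:R / 2 + #|I|%:R / 2 :> R by lra.
apply: le_trans (lerD zA taus); rewrite mulr_sumr -big_split /=.
apply: ler_sum => i _.
set g := \sum_l al z l * B l i; set w := (z i)%:R - c.
have -> : w - lattice_pt B tau (u z) i
    = (w - g) + (g - lattice_pt B tau (u z) i) by ring.
apply: le_trans (ler_normD _ _) _; rewrite lerD2l /lattice_pt !mulr_sumr -sumrB.
apply: le_trans (ler_norm_sum _ _ _) _; apply: ler_sum => l _.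
rewrite mulrA -mulrBl normrM ler_wpM2r // /u.
have /andP[] := mem_rg1_floor (al z l / tau).
rewrite ler_pdivlMr // ltr_pdivrMr // mulrDl mul1r => h1 h2.
by rewrite ger0_norm; lra.
Qed.

(** By Markov's inequality, a mean of at most [#|I| / 4] would put at least half of the grid within
    [#|I| / 2] of the subspace. The condition on [p] says [#|L| <= (1 - 1 / p) * #|I|], and with
    [K = 2 ^ (14 * p)] the counting bound becomes the absurd [14 * #|I| <= 12 * #|I| + 1]. *)
Lemma mean_dist_subspace (R : realType) (I L : finType) (B : L -> I -> R)
    (p K : nat) (al : {ffun I -> 'I_K} -> L -> R) (c : R) :
  (0 < #|I|)%N -> (0 < p)%N -> (p * #|L| + #|I| <= p * #|I|)%N ->
  K = (2 ^ (14 * p))%N -> 0 <= c <= K%:R - 1 ->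
  (K ^ #|I|)%:R * (#|I|%:R / 4) <
    \sum_(z : {ffun I -> 'I_K}) \sum_i `|(z i)%:R - c - \sum_l al z l * B l i|.
Proof.
move=> I0 p0 pLI KE cK; rewrite ltNge; apply/negP => small.
have K4 : (4 <= K)%N by rewrite KE -[4%N]/(2 ^ 2)%N leq_exp2l //; lia.
pose d (z : {ffun I -> 'I_K}) := \sum_i `|(z i)%:R - c - \sum_l al z l * B l i|.
pose A := [set z | d z <= #|I|%:R / 2].
have cardA : (#|A| <= 2 ^ (12 * #|I|) * K ^ #|L|)%N.
  apply: (@card_near_subspace R I L B K A c) => // z.
  by rewrite inE => dz; exists (al z).
have I0R : 0 < #|I|%:R :> R by rewrite ltr0n.
have far : #|~: A|%:R * (#|I|%:R / 2) <= (K ^ #|I|)%:R * (#|I|%:R / 4) :> R.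
  apply: le_trans small; rewrite mulr_natl -sumr_const big_mkcond /=.
  apply: ler_sum => z _; rewrite !inE -ltNge.
  by case: ifP => [/ltW//|_]; apply: sumr_ge0.
have {far} : (2 * #|~: A| <= K ^ #|I|)%N.
  rewrite -(ler_nat R) natrM -(ler_pM2r I0R); lra.
have := cardsC A; rewrite card_ffun card_ord => AE AC.
have : (K ^ #|I| <= 2 * 2 ^ (12 * #|I|) * K ^ #|L|)%N by lia.
rewrite KE -expnS -!expnM -expnD leq_exp2l //.
have := leq_mul (leqnn 14) pLI; rewrite mulnDr !mulnA; lia.
Qed.

(** * Riesz products *)

Local Open Scope classical_set_scope.
Local Open Scope ring_scope.

(** * Integration over one period *)

Section TorusIntegral.
Context {R : realType}.
Implicit Types (f g h : R -> R) (a b x y : R) (m k : nat).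

Local Notation mu := (@lebesgue_measure R).

Definition int01 f : R := (\int[mu]_(t in `[0%R, 1%R]) f t)%R.
Definition integrable01 f : Prop := mu.-integrable `[0, 1] (fun t => (f t)%:E).

Lemma measurable01 : measurable (`[0, 1] : set (measurableTypeR R)).
Proof. by []. Qed.

Lemma integrable01_continuous f : continuous f -> integrable01 f.
Proof.
move=> cf; apply: continuous_compact_integrable; first exact: segment_compact.
exact: continuous_subspaceT.
Qed.

Lemma integrable01D f g :
  integrable01 f -> integrable01 g -> integrable01 (fun t => f t + g t).
Proof.
move=> fi gi; apply: eq_integrable measurable01 _ _ _ (integrableD measurable01 fi gi).
by move=> t _.
Qed.

Lemma integrable01Z a f : integrable01 f -> integrable01 (fun t => a * f t).
Proof.
move=> fi; apply: eq_integrable measurable01 _ _ _ (integrableZl measurable01 a fi).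
by move=> t _.
Qed.

Lemma integrable01_sum (I : Type) (s : seq I) (P : pred I) (F : I -> R -> R) :
  (forall i, integrable01 (F i)) ->
  integrable01 (fun t => \sum_(i <- s | P i) F i t).
Proof.
move=> Fi; rewrite /integrable01.
have := integrable_sum measurable01 s (P := P) (fun i _ => Fi i).
by apply: eq_integrable measurable01 _ _ _ => t _; rewrite sumEFin.
Qed.

Lemma integrable01_mul_continuous f g :
  continuous f -> integrable01 g -> integrable01 (fun t => f t * g t).
Proof.
move=> cf gi.
have mf : measurable_fun (`[0, 1] : set (measurableTypeR R)) f.
  by apply: measurable_funTS; exact: continuous_measurable_fun.
have bf : [bounded f t | t in `[0, 1]].
  have cf01 : {within `[0, 1], continuous f} by exact: continuous_subspaceT.
  have /compact_bounded[M [Mr fM]] := continuous_compact cf01 (@segment_compact R 0 1).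
  by exists M; split => // u Mu t t01 /=; apply: fM Mu _ _; exists t.
apply: eq_integrable measurable01 _ _ _ (integrableMr measurable01 mf bf gi).
by move=> t _.
Qed.

Lemma int01D f g : integrable01 f -> integrable01 g ->
  int01 (fun t => f t + g t) = int01 f + int01 g.
Proof. by move=> *; apply: RintegralD. Qed.

Lemma int01Z a f : integrable01 f -> int01 (fun t => a * f t) = a * int01 f.
Proof. by move=> *; apply: RintegralZl. Qed.

Lemma int01_sum (I : Type) (s : seq I) (P : pred I) (F : I -> R -> R) :
  (forall i, integrable01 (F i)) ->
  int01 (fun t => \sum_(i <- s | P i) F i t) = \sum_(i <- s | P i) int01 (F i).
Proof.
move=> Fi; elim: s => [|i s IHs].
  rewrite big_nil /int01; under eq_Rintegral do rewrite big_nil.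
  by rewrite Rintegral_cst // mul0r.
rewrite big_cons -IHs /int01; case: ifP => Pi.
  rewrite -int01D //; last exact: integrable01_sum.
  by apply: eq_Rintegral => t _; rewrite big_cons Pi.
by apply: eq_Rintegral => t _; rewrite big_cons Pi.
Qed.

Lemma le_int01 f g : integrable01 f -> integrable01 g ->
  (forall t, f t <= g t) -> int01 f <= int01 g.
Proof. by move=> fi gi fg; apply: le_Rintegral. Qed.

Lemma eq_int01 f g : f =1 g -> int01 f = int01 g.
Proof. by move=> /funext ->. Qed.

Lemma ler_norm_int01 f : integrable01 f -> `|int01 f| <= int01 (fun t => `|f t|).
Proof. by move=> fi; apply: le_normr_Rintegral. Qed.

Lemma continuous_addf f g : continuous f -> continuous g ->
  continuous (fun t => f t + g t).
Proof. by move=> cf cg t; apply: cvgD; [exact: cf|exact: cg]. Qed.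

Lemma continuous_mulf f g : continuous f -> continuous g ->
  continuous (fun t => f t * g t).
Proof. by move=> cf cg t; apply: cvgM; [exact: cf|exact: cg]. Qed.

Definition cosT m (t : R) : R := cos (2 * pi * m%:R * t).
Definition sinT m (t : R) : R := sin (2 * pi * m%:R * t).

Lemma continuous_cosT m : continuous (cosT m).
Proof.
move=> t; apply: continuous_comp; last exact: continuous_cos.
by apply: cvgM; [exact: cvg_cst|exact: cvg_id].
Qed.

Lemma continuous_sinT m : continuous (sinT m).
Proof.
move=> t; apply: continuous_comp; last exact: continuous_sin.
by apply: cvgM; [exact: cvg_cst|exact: cvg_id].
Qed.

Lemma cosT0 t : cosT 0 t = 1. Proof. by rewrite /cosT mulr0 mul0r cos0. Qed.
Lemma sinT0 t : sinT 0 t = 0. Proof. by rewrite /sinT mulr0 mul0r sin0. Qed.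

Lemma cosT_int m : cosT m 1 = 1 /\ sinT m 1 = 0.
Proof.
rewrite /cosT /sinT mulr1; elim: m => [|m [IHc IHs]].
  by rewrite mulr0 cos0 sin0.
have -> : 2 * pi * m.+1%:R = 2 * pi * m%:R + pi *+ 2 :> R.
  by rewrite -[m.+1%:R]natr1 mulrDr mulr1 mulr_natl.
by rewrite cosD2pi sinD2pi.
Qed.

Lemma int01_trig m : (0 < m)%N -> int01 (cosT m) = 0 /\ int01 (sinT m) = 0.
Proof.
move=> m0; set w : R := 2 * pi * m%:R.
have w0 : w != 0 by rewrite !mulf_neq0 ?pnatr_eq0 ?gt_eqF ?pi_gt0 // -lt0n.
have dS (t : R) : is_derive t (1 : R) (fun t : R => w^-1 * sinT m t) (cosT m t).
  rewrite /sinT /cosT -/w; apply: is_derive_eq.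
  by rewrite /GRing.scale /=; field.
have dC (t : R) : is_derive t (1 : R) (fun t : R => - w^-1 * cosT m t) (sinT m t).
  rewrite /sinT /cosT -/w; apply: is_derive_eq.
  by rewrite /GRing.scale /=; field.
have ftc (F f : R -> R) : continuous f -> (forall t : R, is_derive t (1 : R) F (f t)) ->
    int01 f = F 1 - F 0.
  move=> cf dF; rewrite /int01 /Rintegral (@continuous_FTC2 _ f F) //.
  - exact: continuous_subspaceT.
  - have cF t : {for t, continuous F}.
      by apply/differentiable_continuous/derivable1_diffP.
    split => [t _ //||]; first exact/cvg_at_right_filter/cF.
    exact/cvg_at_left_filter/cF.
  - by move=> t _; rewrite derive1E derive_val.
have [c1 s1] := cosT_int m.
have c0 : cosT m 0 = 1 by rewrite /cosT mulr0 cos0.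
have s0 : sinT m 0 = 0 by rewrite /sinT mulr0 sin0.
rewrite (ftc _ _ (@continuous_cosT m) dS) (ftc _ _ (@continuous_sinT m) dC).
by rewrite c1 s1 c0 s0 !subrr.
Qed.

(** * Real Fourier coefficients and Riesz factors *)

Definition cosF f m : R := int01 (fun t => f t * cosT m t).
Definition sinF f m : R := int01 (fun t => f t * sinT m t).

Lemma cosF0 f : cosF f 0 = int01 f.
Proof. by apply: eq_int01 => t; rewrite cosT0 mulr1. Qed.

Lemma sinF0 f : sinF f 0 = 0.
Proof.
rewrite /sinF /int01; under eq_Rintegral do rewrite sinT0 mulr0.
by rewrite Rintegral_cst // mul0r.
Qed.

Lemma trig_prod k m t : (m <= k)%N ->
  [/\ cosT k t * cosT m t = (cosT (k + m) t + cosT (k - m) t) / 2,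
      sinT k t * cosT m t = (sinT (k + m) t + sinT (k - m) t) / 2,
      cosT k t * sinT m t = (sinT (k + m) t - sinT (k - m) t) / 2 &
      sinT k t * sinT m t = (cosT (k - m) t - cosT (k + m) t) / 2].
Proof.
move=> mk; rewrite /cosT /sinT.
have -> : 2 * pi * (k + m)%:R * t = 2 * pi * k%:R * t + 2 * pi * m%:R * t.
  by rewrite natrD; ring.
have -> : 2 * pi * (k - m)%:R * t = 2 * pi * k%:R * t - 2 * pi * m%:R * t.
  by rewrite natrB //; ring.
by rewrite cosD sinD cosB sinB; split; field.
Qed.

(** This is [1 + Re (conj z * exp (2 pi i k t)) / 2] with [z = x + i y]. The division by 2 keeps it
    nonnegative for all [x] and [y] in [[-1, 1]]. *)
Definition riesz_factor k x y (t : R) : R :=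
  1 + (x * cosT k t + y * sinT k t) / 2.

Lemma continuous_riesz_factor k x y : continuous (riesz_factor k x y).
Proof.
apply: continuous_addf; first by move=> t; exact: cvg_cst.
apply: continuous_mulf; last by move=> t; exact: cvg_cst.
apply: continuous_addf; apply: continuous_mulf; try by move=> t; exact: cvg_cst.
  exact: continuous_cosT.
exact: continuous_sinT.
Qed.

Lemma riesz_factor_ge0 k x y t : `|x| <= 1 -> `|y| <= 1 -> 0 <= riesz_factor k x y t.
Proof.
rewrite /riesz_factor => x1 y1.
have bound a b : `|a| <= 1 -> `|b| <= 1 -> -1 <= a * b.
  move=> a1 b1; rewrite lerNl (le_trans (ler_norm _)) // normrN normrM.
  by rewrite mulr_ile1.
have := bound x _ x1 (cos_max (2 * pi * k%:R * t)).
have := bound y _ y1 (sin_max (2 * pi * k%:R * t)).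
rewrite -/(cosT k t) -/(sinT k t); lra.
Qed.

Lemma int01_lin4 (f0 f1 f2 f3 f4 : R -> R) a1 a2 a3 a4 :
  continuous f0 -> continuous f1 -> continuous f2 -> continuous f3 ->
  continuous f4 ->
  int01 (fun t => f0 t + a1 * f1 t + a2 * f2 t + a3 * f3 t + a4 * f4 t) =
  int01 f0 + a1 * int01 f1 + a2 * int01 f2 + a3 * int01 f3 + a4 * int01 f4.
Proof.
move=> /integrable01_continuous i0 /integrable01_continuous i1.
move=> /integrable01_continuous i2 /integrable01_continuous i3.
move=> /integrable01_continuous i4.
by rewrite !int01D ?int01Z //; repeat (apply: integrable01D || apply: integrable01Z).
Qed.

Section RieszFactor.
Variables (f : R -> R) (k : nat) (x y : R).
Hypothesis cf : continuous f.

Let g t := f t * riesz_factor k x y t.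

Let ccos m : continuous (fun t => f t * cosT m t).
Proof. by apply: continuous_mulf => //; exact: continuous_cosT. Qed.

Let csin m : continuous (fun t => f t * sinT m t).
Proof. by apply: continuous_mulf => //; exact: continuous_sinT. Qed.

(** Product-to-sum formulas: a factor of frequency [k] shifts frequencies by [k] in both directions.
    The cases [m <= k] and [k <= m] are separate because the sine is odd, so its coefficients at the
    difference frequency change sign. *)
Lemma fourier_riesz_factor_le m : (m <= k)%N ->
  cosF g m = cosF f m + x / 4 * cosF f (k + m) + x / 4 * cosF f (k - m)
             + y / 4 * sinF f (k + m) + y / 4 * sinF f (k - m) /\
  sinF g m = sinF f m + x / 4 * sinF f (k + m) + - (x / 4) * sinF f (k - m)
             + y / 4 * cosF f (k - m) + - (y / 4) * cosF f (k + m).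
Proof.
move=> mk; split; rewrite /cosF /sinF -int01_lin4 //; apply: eq_int01 => t;
  have [cc sc cs ss] := trig_prod t mk; rewrite /g /riesz_factor.
- transitivity (f t * cosT m t + (x / 2 * f t * (cosT k t * cosT m t)
     + y / 2 * f t * (sinT k t * cosT m t))); [by field|rewrite cc sc; by field].
- transitivity (f t * sinT m t + (x / 2 * f t * (cosT k t * sinT m t)
     + y / 2 * f t * (sinT k t * sinT m t))); [by field|rewrite cs ss; by field].
Qed.

Lemma fourier_riesz_factor_ge m : (k <= m)%N ->
  cosF g m = cosF f m + x / 4 * cosF f (m + k) + x / 4 * cosF f (m - k)
             + y / 4 * sinF f (m + k) + - (y / 4) * sinF f (m - k) /\
  sinF g m = sinF f m + x / 4 * sinF f (m + k) + x / 4 * sinF f (m - k)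
             + y / 4 * cosF f (m - k) + - (y / 4) * cosF f (m + k).
Proof.
move=> km; split; rewrite /cosF /sinF -int01_lin4 //; apply: eq_int01 => t;
  have [cc sc cs ss] := trig_prod t km; rewrite /g /riesz_factor.
- transitivity (f t * cosT m t + (x / 2 * f t * (cosT m t * cosT k t)
     + y / 2 * f t * (cosT m t * sinT k t))); [by field|rewrite cc cs; by field].
- transitivity (f t * sinT m t + (x / 2 * f t * (sinT m t * cosT k t)
     + y / 2 * f t * (sinT m t * sinT k t))); [by field|rewrite sc ss; by field].
Qed.

End RieszFactor.

Definition band_limited f (M : nat) : Prop :=
  forall m, (M < m)%N -> cosF f m = 0 /\ sinF f m = 0.

Lemma band_limited1 : band_limited (fun=> 1) 0.
Proof.
move=> m /int01_trig[c0 s0]; rewrite /cosF /sinF.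
by split; [rewrite -c0|rewrite -s0]; apply: eq_int01 => t; rewrite mul1r.
Qed.

Lemma band_limitedM f k x y M : continuous f -> band_limited f M ->
  band_limited (fun t => f t * riesz_factor k x y t) (M + k).
Proof.
move=> cf bf m Mm; have km : (k <= m)%N by lia.
have [-> ->] := fourier_riesz_factor_ge x y cf km.
have [-> ->] := bf m ltac:(lia); have [-> ->] := bf (m + k)%N ltac:(lia).
by have [-> ->] := bf (m - k)%N ltac:(lia); rewrite !mulr0 !addr0.
Qed.

(** * Riesz products: band, mean and Fourier coefficients *)

Section RieszProduct.
Variables (k : nat -> nat) (T : pred nat) (x y : nat -> R).

Definition riesz (n : nat) (t : R) : R :=
  \prod_(j < n | T j) riesz_factor (k j) (x j) (y j) t.

(** A bound for the degree of [riesz n] as a trigonometric polynomial. *)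
Definition riesz_band (n : nat) : nat := (\sum_(j < n | T j) k j)%N.

Lemma riesz0 : riesz 0 = fun=> 1.
Proof. by apply/funext => t; rewrite /riesz big_ord0. Qed.

Lemma rieszS n : riesz n.+1 =
  if T n then fun t => riesz n t * riesz_factor (k n) (x n) (y n) t else riesz n.
Proof.
apply/funext => t; rewrite /riesz big_mkcond big_ord_recr /= -big_mkcond.
by case: (T n); rewrite ?mulr1.
Qed.

Lemma riesz_bandS n : riesz_band n.+1 =
  if T n then (riesz_band n + k n)%N else riesz_band n.
Proof.
rewrite /riesz_band big_mkcond big_ord_recr /= -big_mkcond.
by case: (T n); rewrite ?addn0.
Qed.

Lemma continuous_riesz n : continuous (riesz n).
Proof.
elim: n => [|n IHn]; first by rewrite riesz0 => t; exact: cvg_cst.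
rewrite rieszS; case: (T n) => //.
by apply: continuous_mulf => //; exact: continuous_riesz_factor.
Qed.

Lemma band_limited_riesz n : band_limited (riesz n) (riesz_band n).
Proof.
elim: n => [|n IHn]; first by rewrite riesz0 /riesz_band big_ord0; exact: band_limited1.
rewrite rieszS riesz_bandS; case: (T n) => //.
by apply: band_limitedM => //; exact: continuous_riesz.
Qed.

Hypothesis band_lt : forall j, (riesz_band j < k j)%N.
Hypothesis band_dissociate :
  forall i j, (i < j)%N -> T j -> (riesz_band j + k i < k j)%N.

(** The factor of index [n] changes the mean only by multiples of the coefficients at [k n], which
    lies beyond the band of [riesz n], so the initial value 1 persists. *)
Lemma int01_riesz n : int01 (riesz n) = 1.
Proof.
elim: n => [|n IHn].
  rewrite riesz0 /int01 Rintegral_cst //= lebesgue_measure_itv /= lte01.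
  by rewrite oppr0 adde0 mulr1.
rewrite rieszS; case: (T n) => //; rewrite -cosF0.
have [-> _] := fourier_riesz_factor_le (x n) (y n) (@continuous_riesz n) (leq0n (k n)).
have [-> ->] := band_limited_riesz (m := (k n + 0)%N) ltac:(by rewrite addn0).
have [-> ->] := band_limited_riesz (m := (k n - 0)%N) ltac:(by rewrite subn0).
by rewrite cosF0 IHn !mulr0 !addr0.
Qed.

(** Three regimes. Until the index [i] is reached, [k i] is beyond the band. If [T i], the factor of
    index [i], multiplied by a product of mean 1, creates [x i / 4] and [y i / 4]. A later factor of
    frequency [k n] brings in only coefficients at [k n + k i] and [k n - k i], which
    [band_dissociate] places beyond the band. *)
Lemma fourier_riesz n i :
  cosF (riesz n) (k i) = (if (i < n)%N && T i then x i / 4 else 0) /\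
  sinF (riesz n) (k i) = (if (i < n)%N && T i then y i / 4 else 0).
Proof.
have le_band m m' : (m <= m')%N -> (riesz_band m <= riesz_band m')%N.
  elim: m' => [|m' IH]; first by rewrite leqn0 => /eqP ->.
  rewrite leq_eqVlt => /predU1P[->//|/IH le].
  by rewrite riesz_bandS; case: ifP => // _; lia.
elim: n => [|n [IHc IHs]].
  by have := band_limited_riesz (leq_ltn_trans (le_band 0%N i isT) (band_lt i)).
have [ni|] := ltnP n i.
  have -> : (i < n.+1)%N = false by lia.
  exact: band_limited_riesz (leq_ltn_trans (le_band _ _ ni) (band_lt i)).
rewrite rieszS leq_eqVlt => /predU1P[in_eq|i_lt_n]; last first.
  have -> : (i < n.+1)%N by lia.
  rewrite i_lt_n /= in IHc IHs; have [Tn|_] := boolP (T n); last by [].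
  have := band_dissociate i_lt_n Tn => dis.
  have ki_le_kn : (k i <= k n)%N by lia.
  have [-> ->] := fourier_riesz_factor_le (x n) (y n) (@continuous_riesz n) ki_le_kn.
  rewrite IHc IHs.
  have [-> ->] := @band_limited_riesz n (k n + k i)%N ltac:(lia).
  have [-> ->] := @band_limited_riesz n (k n - k i)%N ltac:(lia).
  by rewrite !mulr0 !addr0.
rewrite in_eq ltnn /= in IHc IHs *; rewrite ltnS leqnn /=.
have [_|//] := boolP (T n).
have [-> ->] := fourier_riesz_factor_le (x n) (y n) (@continuous_riesz n) (leqnn (k n)).
have [-> ->] := @band_limited_riesz n (k n + k n)%N ltac:(have := band_lt n; lia).
by rewrite IHc IHs subnn cosF0 sinF0 int01_riesz; split; ring.
Qed.

End RieszProduct.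

End TorusIntegral.

(** * Lacunary frequencies *)

Lemma exprn_unbounded (R : realType) (q b : R) : 1 < q ->
  exists2 r, (0 < r)%N & b <= q ^+ r.
Proof.
move=> q1; have bernoulli r : r%:R * (q - 1) <= q ^+ r.
  elim: r => [|r IHr]; first by rewrite mul0r expr0.
  have q_ge1 : 1 <= q ^+ r by rewrite exprn_ege1 // ltW.
  rewrite exprS -natr1; nra.
exists (Num.truncn (b / (q - 1))).+1 => //; apply: le_trans (bernoulli _).
by rewrite -ler_pdivrMr ?subr_gt0 // ltW // truncnS_gt.
Qed.

Lemma eq_residue_leq r i j : (i < j)%N -> i = j %[mod r] -> (i + r <= j)%N.
Proof.
move=> ij ijr; rewrite -leq_subRL ?(ltnW ij) // dvdn_leq ?subn_gt0 //.
by rewrite -eqn_mod_dvd ?ijr // ltnW.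
Qed.

Section LacunaryResidues.
Context {R : realType}.
Variables (q : R) (k : nat -> nat).
Hypotheses (q1 : 1 < q) (k0 : (0 < k 0)%N).
Hypothesis lac : forall j, q * (k j)%:R <= (k j.+1)%:R.

Lemma lacunary_gt0 j : (0 < k j)%N.
Proof.
elim: j => // j; rewrite -!(ltr_nat R) => kj.
by apply: lt_le_trans (lac j); rewrite mulr_gt0 // (lt_trans ltr01).
Qed.

Lemma lacunary_ltn i j : (i < j)%N -> q * (k i)%:R <= (k j)%:R.
Proof.
elim: j => // j IHj; rewrite ltnS leq_eqVlt => /predU1P[->|/IHj]; first exact: lac.
move=> /le_trans; apply; apply: le_trans (lac j).
by rewrite ler_peMl // ltW.
Qed.

Variables (r a : nat) (th : R).
Hypotheses (r0 : (0 < r)%N) (th0 : 0 <= th) (thr : 1 + th <= th * q ^+ r).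

Local Notation T := (fun j => (j %% r == a)%N).

(** The exponent [s] records how far [n] is past the last chosen index. At a chosen [n] the previous
    one is at least [r] back, so induction with [s = r] and [thr] bound the band by [th * k n];
    adding [k n] gives [(1 + th) * k n]. Each further index gains a factor [q]. *)
Lemma riesz_band_le n s :
  (forall j, (j < n)%N -> T j -> (j + s <= n)%N) ->
  (riesz_band k T n)%:R * q ^+ s <= (1 + th) * (k n)%:R.
Proof.
have q0 : 0 < q by apply: lt_trans q1.
elim: n s => [|n IHn] s gap.
  by rewrite /riesz_band big_ord0 mul0r mulr_ge0 // addr_ge0.
have kn_ge0 : 0 <= (k n)%:R :> R by [].
have step : (1 + th) * (k n)%:R * q <= (1 + th) * (k n.+1)%:R.
  by rewrite -mulrA ler_wpM2l ?addr_ge0 // mulrC lac.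
have M0 : 0 <= (riesz_band k T n)%:R :> R by [].
rewrite riesz_bandS; case: ifPn => [Tn|nTn].
  have s1 : (s <= 1)%N by have := gap n (ltnSn n) Tn; lia.
  apply: le_trans step; apply: (@le_trans _ _ ((1 + th) * (k n)%:R * q ^+ s)).
    apply: ler_wpM2r; first by rewrite exprn_ge0 ?ltW.
    rewrite natrD mulrDl mul1r [leLHS]addrC lerD2l.
    have qr0 : 0 < q ^+ r by rewrite exprn_gt0.
    rewrite -(ler_pM2r qr0); apply: le_trans (IHn r _) _.
      by move=> j jn /eqP Tj; apply: eq_residue_leq => //; rewrite Tj (eqP Tn).
    by rewrite mulrAC ler_wpM2r.
  rewrite ler_wpM2l ?mulr_ge0 ?addr_ge0 //.
  by case: s s1 {gap} => [|[|//]] _; rewrite ?expr1 // expr0 ltW.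
case: s gap => [|s] gap.
  apply: le_trans (le_trans (IHn 0%N _) _); rewrite ?expr0 //.
    by move=> j jn _; rewrite addn0 ltnW.
  apply: le_trans step; apply: ler_peMr; last exact: ltW.
  by rewrite mulr_ge0 ?addr_ge0.
rewrite exprSr mulrA; apply: le_trans step; apply: ler_wpM2r; first exact: ltW.
by apply: IHn => j jn Tj; have := gap j (ltnW jn) Tj; lia.
Qed.

Hypotheses (th_q : th + q^-1 < 1) (th_q' : 1 + th < q).

Lemma lacunary_band_class j : T j -> (riesz_band k T j)%:R <= th * (k j)%:R :> R.
Proof.
move=> /eqP Tj; have qr0 : 0 < q ^+ r by rewrite exprn_gt0 // (lt_trans ltr01).
rewrite -(ler_pM2r qr0); apply: le_trans (@riesz_band_le j r _) _.
  by move=> i ij /eqP Ti; apply: eq_residue_leq => //; rewrite Ti Tj.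
by rewrite mulrAC ler_wpM2r.
Qed.

(** The earlier frequencies of the class add up to at most [th * k j], and [k i], of whatever class,
    is at most [k j / q]; the total stays below [k j] because [th + 1 / q < 1]. *)
Lemma lacunary_band_dissociate i j :
  (i < j)%N -> T j -> (riesz_band k T j + k i < k j)%N.
Proof.
move=> ij Tj; rewrite -(ltr_nat R) natrD.
have q0 : 0 < q by apply: lt_trans q1.
have kj : 0 < (k j)%:R :> R by rewrite ltr0n lacunary_gt0.
apply: (@le_lt_trans _ _ ((th + q^-1) * (k j)%:R)); last by rewrite gtr_pMl.
rewrite mulrDl lerD ?lacunary_band_class //.
by rewrite mulrC ler_pdivlMr // mulrC lacunary_ltn.
Qed.

(** For [j] outside the class only the gap [s = 1] is certain, and [1 + th < q] makes it enough. *)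
Lemma lacunary_band_lt j : (riesz_band k T j < k j)%N.
Proof.
have q0 : 0 < q by apply: lt_trans q1.
have kj : 0 < (k j)%:R :> R by rewrite ltr0n lacunary_gt0.
rewrite -(ltr_nat R) -(ltr_pM2r q0).
apply: (@le_lt_trans _ _ ((1 + th) * (k j)%:R)); last by rewrite mulrC ltr_pM2l.
by apply: (@riesz_band_le j 1%N) => i ij _; rewrite addn1.
Qed.

End LacunaryResidues.

(** Splitting the indices modulo [r] leaves in each class frequencies sparse enough for Riesz
    products. As [r] depends on [q] alone, the final constant will not depend on [k]. *)
Lemma lacunary_residue_classes (R : realType) (q : R) : 1 < q ->
  exists2 r, (0 < r)%N & forall k : nat -> nat, (0 < k 0)%N ->
    (forall j, q * (k j)%:R <= (k j.+1)%:R) -> forall a,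
    let T := fun j => (j %% r == a)%N in
    (forall j, (riesz_band k T j < k j)%N) /\
    (forall i j, (i < j)%N -> T j -> (riesz_band k T j + k i < k j)%N).
Proof.
move=> q1; have q0 : 0 < q by apply: lt_trans q1.
(* Then [th + 1 / q = (q + 1) / (2 * q) < 1] and [th < q - 1]. *)
pose th := (q - 1) / (2 * q).
have th0 : 0 < th by rewrite divr_gt0 ?subr_gt0 ?mulr_gt0.
have thE : th * (2 * q) = q - 1 by rewrite divfK // gt_eqF ?mulr_gt0.
have [r r0 qr] := exprn_unbounded ((1 + th) / th) q1.
have thr : 1 + th <= th * q ^+ r by rewrite mulrC -ler_pdivrMr.
have th_q : th + q^-1 < 1.
  by rewrite -(ltr_pM2r q0) mulrDl mulVf ?gt_eqF // mul1r; lra.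
have th_q' : 1 + th < q by nra.
exists r => // k k0 lac a T; split=> [j|i j].
  exact: (@lacunary_band_lt R q k q1 k0 lac r a th r0 (ltW th0) thr).
exact: (@lacunary_band_dissociate R q k q1 k0 lac r a th r0 (ltW th0) thr th_q).
Qed.

(** * Averages over the grid of coefficients *)

Section GridMean.
Context {R : realType} (K : nat).

Definition grid (v : 'I_K) : R := (2 * v%:R - (K%:R - 1)) / (K%:R - 1).

Hypothesis K1 : (1 < K)%N.

Let K1R : 0 < K%:R - 1 :> R. Proof. by rewrite subr_gt0 ltr1n. Qed.

Lemma grid_norm_le1 v : `|grid v| <= 1.
Proof.
have : v%:R + 1 <= K%:R :> R by rewrite natr1 ler_nat ltn_ord.
have : 0 <= v%:R :> R by [].
by move=> *; rewrite ler_norml /grid ler_pdivlMr // ler_pdivrMr //; lra.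
Qed.

Lemma sum_grid : \sum_v grid v = 0.
Proof.
rewrite /grid -mulr_suml sumrB -mulr_sumr sumr_const card_ord.
suff -> : 2 * (\sum_(v < K) v%:R) = K%:R * (K%:R - 1) :> R.
  by rewrite mulr_natl subrr mul0r.
elim: K => [|n IHn]; first by rewrite big_ord0 mulr0 mul0r.
by rewrite big_ord_recr /= mulrDr IHn -natr1; ring.
Qed.

(** The boolean selects the real ([false]) or imaginary ([true]) part of the coefficient. Indices
    from [N] on get 0, which respects the bound by 1 and never enters a product over [j < N]. *)
Definition grid_seq N (z : {ffun 'I_N * bool -> 'I_K}) (b : bool) (j : nat) : R :=
  if insub j is Some i then grid (z (i, b)) else 0.

Lemma grid_seqE N (z : {ffun 'I_N * bool -> 'I_K}) b (i : 'I_N) :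
  grid_seq z b i = grid (z (i, b)).
Proof. by rewrite /grid_seq valK. Qed.

Lemma grid_seq_norm_le1 N (z : {ffun 'I_N * bool -> 'I_K}) b j :
  `|grid_seq z b j| <= 1.
Proof.
rewrite /grid_seq; case: insub => [i|]; first exact: grid_norm_le1.
by rewrite normr0.
Qed.

(** The coordinates of [z] are independent, so the sum of the products is a product over [i] of sums
    of single factors; each factor has mean 1 since the grid has mean 0. *)
Lemma sum_riesz N k T t :
  \sum_(z : {ffun 'I_N * bool -> 'I_K})
    riesz k T (grid_seq z false) (grid_seq z true) N t =
  #|{ffun 'I_N * bool -> 'I_K}|%:R.
Proof.
pose h (w : {ffun 'I_N -> 'I_K * 'I_K}) : {ffun 'I_N * bool -> 'I_K} :=
  [ffun p => if p.2 then (w p.1).2 else (w p.1).1].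
pose h' (z : {ffun 'I_N * bool -> 'I_K}) : {ffun 'I_N -> 'I_K * 'I_K} :=
  [ffun i => (z (i, false), z (i, true))].
have hK : cancel h h'.
  by move=> w; apply/ffunP => i; rewrite !ffunE /=; case: (w i).
have h'K : cancel h' h by move=> z; apply/ffunP => -[i []]; rewrite !ffunE.
rewrite (reindex h) /=; last by exists h' => [w _|z _]; [exact: hK|exact: h'K].
pose F (i : 'I_N) (p : 'I_K * 'I_K) : R :=
  if T i then riesz_factor (k i) (grid p.1) (grid p.2) t else 1.
transitivity (\sum_(w : {ffun 'I_N -> 'I_K * 'I_K}) \prod_i F i (w i)).
  apply: eq_bigr => w _; rewrite /riesz big_mkcond; apply: eq_bigr => i _.
  by rewrite /F !grid_seqE !ffunE.
rewrite -bigA_distr_bigA /=.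
have cardE : #|{ffun 'I_N * bool -> 'I_K}| = ((K * K) ^ N)%N.
  by rewrite card_ffun card_prod card_bool !card_ord mulnC expnM expnS expn1.
rewrite cardE natrX -[X in _ ^+ X](card_ord N) -prodr_const.
apply: eq_bigr => i _; rewrite /F; case: (T i); last first.
  by rewrite sumr_const card_prod !card_ord.
rewrite -(pair_bigA _ (fun u v => riesz_factor (k i) (grid u) (grid v) t)) /=.
rewrite /riesz_factor.
transitivity (\sum_(u < K) (K%:R * (1 + grid u * cosT (k i) t / 2))).
  apply: eq_bigr => u _; rewrite big_split /= -mulr_suml big_split /=.
  rewrite -[X in _ + (_ + X) / _]mulr_suml sum_grid !sumr_const !card_ord.
  by rewrite -[(_ * _) *+ K]mulr_natl; field.
rewrite -mulr_sumr big_split /= -[X in _ + X]mulr_suml.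
rewrite -[X in _ + X / _]mulr_suml sum_grid sumr_const card_ord natrM.
by rewrite !mul0r addr0.
Qed.

End GridMean.

(** * Widths *)

Section RieszDuality.
Context {R : realType} (K : nat).
Hypothesis K1 : (1 < K)%N.
Variables (k : nat -> nat) (r N : nat).
Hypothesis r0 : (0 < r)%N.
Let T (a j : nat) := (j %% r == a)%N.
Hypothesis band_lt : forall a j, (riesz_band k (T a) j < k j)%N.
Hypothesis dissociate :
  forall a i j, (i < j)%N -> T a j -> (riesz_band k (T a) j + k i < k j)%N.

Local Notation W := {ffun 'I_N * bool -> 'I_K}.

Definition riesz_sum (z : W) (t : R) : R :=
  \sum_(a < r) riesz k (fun j => j %% r == a)%N (grid_seq z false) (grid_seq z true) N t.

Lemma continuous_riesz_sum z : continuous (riesz_sum z).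
Proof.
have -> : riesz_sum z = \sum_(a < r)
    riesz k (T a) (grid_seq z false) (grid_seq z true) N.
  by apply/funext => t; rewrite fct_sumE.
elim/big_ind: _ => [t|f g cf cg|a _]; first exact: cvg_cst.
  exact: continuous_addf.
exact: continuous_riesz.
Qed.

Lemma riesz_sum_ge0 z t : 0 <= riesz_sum z t.
Proof.
apply: sumr_ge0 => a _; apply: prodr_ge0 => j _.
by apply: riesz_factor_ge0; apply: grid_seq_norm_le1.
Qed.

Lemma sum_riesz_sum t : \sum_(z : W) riesz_sum z t = r%:R * #|{: W}|%:R.
Proof.
rewrite exchange_big /=; under eq_bigr do rewrite sum_riesz //.
by rewrite sumr_const card_ord mulr_natl.
Qed.

Lemma fourier_riesz_sum (z : W) (i : 'I_N) :
  int01 (fun t => riesz_sum z t * cosT (k i) t) = grid (z (i, false)) / 4 /\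
  int01 (fun t => riesz_sum z t * sinT (k i) t) = grid (z (i, true)) / 4.
Proof.
pose i0 := Ordinal (ltn_pmod i r0).
pose rz (a : 'I_r) : R -> R := riesz k (T a) (grid_seq z false) (grid_seq z true) N.
have rzF (a : 'I_r) : cosF (rz a) (k i) = (if a == i0 then grid (z (i, false)) / 4 else 0)
    /\ sinF (rz a) (k i) = (if a == i0 then grid (z (i, true)) / 4 else 0).
  have := @fourier_riesz R k (T a) (grid_seq z false) (grid_seq z true) (band_lt a)
    (@dissociate a) N i.
  rewrite ltn_ord !grid_seqE.
  by have -> : T a i = (a == i0) by rewrite /T eq_sym.
have ci (a : 'I_r) h : continuous h -> integrable01 (fun t => rz a t * h t).
  move=> ch; apply: integrable01_continuous; apply: continuous_mulf => //.
  exact: continuous_riesz.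
have sumE h : continuous h ->
    int01 (fun t => riesz_sum z t * h t) = \sum_a int01 (fun t => rz a t * h t).
  move=> ch; rewrite -int01_sum; last by move=> a; apply: ci.
  by apply: eq_int01 => t; rewrite mulr_suml.
rewrite !sumE; [|exact: continuous_sinT|exact: continuous_cosT].
split; rewrite (bigD1 i0) //= big1 => [|a /negbTE ai0].
- by have [] := rzF i0; rewrite eqxx /cosF => -> _; rewrite addr0.
- by have [] := rzF a; rewrite ai0 /cosF.
- by have [] := rzF i0; rewrite eqxx /sinF => _ ->; rewrite addr0.
- by have [] := rzF a; rewrite ai0 /sinF.
Qed.

(** The kernels are nonnegative, so each term is at most the integral of [riesz_sum z] times
    [|f - g|]. Summed over [z], they give the constant [r * #|W|] at every point, so no bound on
    individual kernels enters. *)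
Lemma sum_riesz_pairing (f g : R -> R) : continuous f -> integrable01 g ->
  \sum_(z : W) `|int01 (fun t => riesz_sum z t * f t)
                 - int01 (fun t => riesz_sum z t * g t)|
    <= r%:R * #|{: W}|%:R * int01 (fun t => `|f t - g t|).
Proof.
move=> cf ig; have idf : integrable01 (fun t => f t - g t).
  apply: integrable01D; first exact: integrable01_continuous.
  have := integrable01Z (-1) ig; congr (integrable01 _).
  by apply/funext => t; rewrite mulN1r.
have iad : integrable01 (fun t => `|f t - g t|).
  have := integrable_norm idf; congr (integrable01 _).
rewrite -int01Z //.
have -> : int01 (fun t => r%:R * #|{: W}|%:R * `|f t - g t|) =
    \sum_(z : W) int01 (fun t => riesz_sum z t * `|f t - g t|).
  rewrite -int01_sum => [|z].
    by apply: eq_int01 => t; rewrite -mulr_suml sum_riesz_sum.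
  by apply: integrable01_mul_continuous => //; exact: continuous_riesz_sum.
apply: ler_sum => z _; have cz := @continuous_riesz_sum z.
have -> : int01 (fun t => riesz_sum z t * f t) - int01 (fun t => riesz_sum z t * g t)
    = int01 (fun t => riesz_sum z t * (f t - g t)).
  rewrite -mulN1r -int01Z; last exact: integrable01_mul_continuous.
  rewrite -int01D.
  - by apply: eq_int01 => t; ring.
  - by apply: integrable01_mul_continuous => //; apply: integrable01_continuous.
  - by apply: integrable01Z; apply: integrable01_mul_continuous.
apply: le_trans (ler_norm_int01 _) _; first exact: integrable01_mul_continuous.
have -> : (fun t => `|riesz_sum z t * (f t - g t)|) =
    (fun t => riesz_sum z t * `|f t - g t|).
  by apply/funext => t; rewrite normrM ger0_norm // riesz_sum_ge0.
by [].
Qed.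

End RieszDuality.

(** * The L1 norm through real and imaginary parts *)

Section L1Norm.
Context {R : realType}.
Local Notation normc := ComplexField.Normc.normc.

Lemma normc_bounds (w : R[i]) :
  [/\ `|complex.Re w| <= normc w, `|complex.Im w| <= normc w &
      normc w <= `|complex.Re w| + `|complex.Im w|].
Proof.
case: w => a b /=; split.
- by rewrite -(sqrtr_sqr a); apply: ler_wsqrtr; rewrite lerDl sqr_ge0.
- by rewrite -(sqrtr_sqr b); apply: ler_wsqrtr; rewrite lerDr sqr_ge0.
- rewrite -[leRHS]ger0_norm ?addr_ge0 // -sqrtr_sqr; apply: ler_wsqrtr.
  rewrite -(real_normK (num_real a)) -(real_normK (num_real b)).
  have := mulr_ge0 (normr_ge0 a) (normr_ge0 b); nra.
Qed.

Lemma integrable01_L1T (f : L1T R) :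
  [/\ integrable01 (fun t => complex.Re (f t)),
      integrable01 (fun t => complex.Im (f t)) &
      integrable01 (fun t => normc (f t))].
Proof.
have := L1T_funP f; rewrite inE => -[_ rf jf]; split => //.
have mRe := measurable_int _ rf; have mIm := measurable_int _ jf.
have dom : integrable01 (fun t => `|complex.Re (f t)| + `|complex.Im (f t)|).
  by apply: integrable01D; [have := integrable_norm rf|have := integrable_norm jf].
apply: le_integrable dom => //.
  apply/measurable_EFinP.
  have -> : (fun t => normc (f t)) =
      Num.sqrt \o (fun t => complex.Re (f t) ^+ 2 + complex.Im (f t) ^+ 2).
    by apply/funext => t /=; case: (f t).
  apply: measurableT_comp.
    by apply: continuous_measurable_fun; exact: sqrt_continuous.
  by apply: measurable_funD; apply: measurable_funX; apply/measurable_EFinP.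
move=> t _; have [_ _ le] := normc_bounds (f t); rewrite /= lee_fin.
rewrite ger0_norm ?(le_trans le) ?ler_norm //.
by have [le' _ _] := normc_bounds (f t); apply: le_trans le'.
Qed.

Lemma L1norm_ge (f : L1T R) :
  int01 (fun t => `|complex.Re (f t)|) <= L1norm f /\
  int01 (fun t => `|complex.Im (f t)|) <= L1norm f.
Proof.
have [ir ij inorm] := integrable01_L1T f.
split; apply: le_int01 => //; try by move=> t; have [] := normc_bounds (f t).
  by have := integrable_norm ir.
by have := integrable_norm ij.
Qed.

Lemma L1T_linear_combination n (a : 'I_n -> R[i]) (b : 'I_n -> L1T R) t :
  (\sum_(l < n) a l *: b l : L1T R) t = \sum_(l < n) a l * b l t.
Proof.
have -> : L1T_fun (\sum_(l < n) a l *: b l) = \sum_(l < n) a l *: L1T_fun (b l).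
  by rewrite -[L1T_fun _]/(\val _) raddf_sum; apply: eq_bigr.
by rewrite fct_sumE.
Qed.

Lemma kolmogorov_width_lt n N (f : 'I_N -> L1T R) (c : R) :
  (kolmogorov_width (@L1norm R) n f < c%:E)%E ->
  exists (b : 'I_n -> L1T R) (a : 'I_N -> 'I_n -> R[i]),
    forall i, L1norm (f i - \sum_(l < n) a i l *: b l) < c.
Proof.
move=> /ereal_inf_lt[_ [_ [b _ <-] <-] max_lt]; exists b.
have near i : exists a : 'I_n -> R[i], L1norm (f i - \sum_(l < n) a l *: b l) < c.
  have : (dist_to (@L1norm R) (f i) (span_of b) < c%:E)%E.
    by apply: le_lt_trans max_lt; apply: (le_bigmax_cond _ (fun i => dist_to _ (f i) _)).
  by move=> /ereal_inf_lt[_ [_ [a _ <-] <-]]; rewrite lte_fin; exists a.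
by have [a aP] := choice near; exists a.
Qed.

End L1Norm.

(** * The lower bound for the width *)

Section WidthLowerBound.
Context {R : realType}.

Lemma lacunary_width_ge (k : nat -> nat) (r p N n : nat) :
  (0 < r)%N -> (0 < p)%N -> (0 < N)%N -> (p * n + N <= p * N)%N ->
  (forall a j, (riesz_band k (fun j => j %% r == a) j < k j))%N ->
  (forall a i j, i < j -> j %% r == a ->
     riesz_band k (fun j => j %% r == a) j + k i < k j)%N ->
  ((8 * (2 ^ (14 * p))%:R * r%:R)^-1%:E <=
    kolmogorov_width (@L1norm R) n (fun j : 'I_N => expT (k j)))%E.
Proof.
move=> r0 p0 N0 pnN band_lt dissociate; set K := (2 ^ (14 * p))%N.
rewrite leNgt; apply/negP => /kolmogorov_width_lt[b [a abP]].
have K1 : (1 < K)%N by rewrite -[1%N]/(2 ^ 0)%N ltn_exp2l // muln_gt0.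
have K1R : 0 < K%:R - 1 :> R by rewrite subr_gt0 ltr1n.
pose I : finType := ('I_N * bool)%type; pose L : finType := ('I_n * bool)%type.
(* The real matrix of multiplication by the complex numbers [a i l], [true] marking imaginary parts:
   [n] complex vectors in dimension [N] become [2 * n] real ones in dimension [2 * N]. *)
pose B (l : L) (i : I) : R := let w := a i.1 l.1 in
  if i.2 then if l.2 then complex.Re w else complex.Im w
  else if l.2 then - complex.Im w else complex.Re w.
(* Only these coefficients depend on [z]; the subspace spanned by the [B l] is fixed. *)
pose be (z : {ffun I -> 'I_K}) (l : L) : R := int01 (fun t => riesz_sum k r z t *
  (if l.2 then complex.Im (b l.1 t) else complex.Re (b l.1 t))).
pose v i : L1T R := \sum_(l < n) a i l *: b l.
have ReM (w w' : R[i]) : complex.Re (w * w') =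
    complex.Re w * complex.Re w' - complex.Im w * complex.Im w'.
  by case: w w' => [? ?] [? ?].
have ImM (w w' : R[i]) : complex.Im (w * w') =
    complex.Re w * complex.Im w' + complex.Im w * complex.Re w'.
  by case: w w' => [? ?] [? ?].
pose part (s : bool) (w : R[i]) := if s then complex.Im w else complex.Re w.
have partv i s t : part s (v i t) = \sum_(l : L) B l (i, s) * part l.2 (b l.1 t).
  rewrite -(pair_bigA _ (fun l u => B (l, u) (i, s) * part u (b l t))) /=.
  rewrite L1T_linear_combination; case: s; rewrite /part raddf_sum;
    apply: eq_bigr => l _; rewrite big_bool /B /= ?ReM ?ImM; ring.
have ipart s (f : L1T R) : integrable01 (fun t => part s (f t)).
  by have [ir ij _] := integrable01_L1T f; case: s.
have beE z i s : \sum_l be z l * B l (i, s) =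
    int01 (fun t => riesz_sum k r z t * part s (v i t)).
  transitivity (int01 (fun t => \sum_(l : L) B l (i, s) *
      (riesz_sum k r z t * part l.2 (b l.1 t)))).
    have ib (l : L) : integrable01 (fun t => riesz_sum k r z t * part l.2 (b l.1 t)).
      by apply: integrable01_mul_continuous => //; exact: continuous_riesz_sum.
    rewrite int01_sum => [|l]; last exact: integrable01Z.
    by apply: eq_bigr => l _; rewrite int01Z // mulrC.
  by apply: eq_int01 => t; rewrite partv mulr_sumr; apply: eq_bigr => l _; ring.
pose trig (s : bool) := if s then @sinT R else @cosT R.
(* The kernel pairs with the character to [grid / 4] and with its approximant to a coordinate of a
   vector of the subspace; [sum_riesz_pairing] bounds the total gap by the L1 distance. *)
have err i s : \sum_(z : {ffun I -> 'I_K})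
    `|grid (z (i, s)) / 4 - \sum_l be z l * B l (i, s)| <=
    r%:R * #|{ffun I -> 'I_K}|%:R * (8 * K%:R * r%:R)^-1.
  have ct : continuous (trig s (k i)).
    by case: s; [exact: continuous_sinT|exact: continuous_cosT].
  apply: (@le_trans _ _ (r%:R * #|{ffun I -> 'I_K}|%:R *
      int01 (fun t => `|trig s (k i) t - part s (v i t)|))); last first.
    rewrite ler_wpM2l ?mulr_ge0 // (le_trans _ (ltW (abP i))) //.
    have -> : (fun t => `|trig s (k i) t - part s (v i t)|) =
        (fun t => `|part s ((expT (k i) - v i) t)|).
      apply/funext => t.
      have -> : (expT (k i) - v i : L1T R) t = expT (k i) t - v i t by [].
      by case: s {ct}; rewrite /part raddfB.
    by have [hr hj] := L1norm_ge (expT (k i) - v i); case: s {ct}.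
  apply: le_trans (sum_riesz_pairing K1 k r N ct (ipart s (v i))).
  rewrite le_eqVlt; apply/orP; left; apply/eqP; apply: eq_bigr => z _.
  have [cE sE] := @fourier_riesz_sum R K k r N r0 band_lt dissociate z i.
  by rewrite beE; case: s {ct}; rewrite /= ?cE ?sE.
have cardI : #|I| = (N * 2)%N by rewrite card_prod card_bool card_ord.
have cardL : #|L| = (n * 2)%N by rewrite card_prod card_bool card_ord.
(* Scaling by [2 * (K - 1)] turns [grid v / 4] into [v - (K - 1) / 2], the integer coordinate
   measured from the centre of the grid. *)
have : (K ^ #|I|)%:R * (#|I|%:R / 4) < \sum_(z : {ffun I -> 'I_K}) \sum_i
    `|(z i)%:R - (K%:R - 1) / 2 - \sum_l 2 * (K%:R - 1) * be z l * B l i|.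
  apply: (@mean_dist_subspace R I L B p K
    (fun z l => 2 * (K%:R - 1) * be z l)) => //; rewrite ?cardI ?cardL.
  - by rewrite muln_gt0 N0.
  - by rewrite !mulnA -mulnDl leq_mul2r pnN.
  - by apply/andP; split; lra.
apply/negP; rewrite -leNgt exchange_big /=.
apply: (@le_trans _ _ (\sum_(i : I) 2 * (K%:R - 1) *
    (r%:R * #|{ffun I -> 'I_K}|%:R * (8 * K%:R * r%:R)^-1))).
  apply: ler_sum => -[i s] _; apply: le_trans (ler_wpM2l _ (err i s)); last first.
    by rewrite mulr_ge0 // ltW.
  rewrite mulr_sumr; apply: ler_sum => z _.
  have K1_ge0 : 0 <= 2 * (K%:R - 1) :> R by rewrite mulr_ge0 // ltW.
  rewrite -[X in _ <= X * _](ger0_norm K1_ge0) -normrM [in leRHS]mulrBr.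
  rewrite le_eqVlt; apply/orP; left; apply/eqP; congr (Num.norm (_ - _)).
    by rewrite /grid; field; rewrite gt_eqF.
  by rewrite mulr_sumr; apply: eq_bigr => l _; rewrite mulrA.
rewrite sumr_const card_ffun card_ord cardI.
rewrite -[_ *+ (N * 2)]mulr_natl natrM.
have rR : 0 < r%:R :> R by rewrite ltr0n.
have KR : 0 < K%:R :> R by rewrite ltr0n; lia.
set C := (K ^ _)%:R; have C0 : 0 <= C :> R by [].
(* With the constant [8 * K * r] the upper bound is [(K - 1) / K] times the strict lower bound, a
   contradiction. *)
have -> : N%:R * 2 * (2 * (K%:R - 1) * (r%:R * C * (8 * K%:R * r%:R)^-1))
    = C * (N%:R * 2 / 4) * ((K%:R - 1) / K%:R) :> R.
  by field; rewrite !gt_eqF.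
rewrite ler_piMr ?mulr_ge0 // ler_pdivrMr //; lra.
Qed.

End WidthLowerBound.

Theorem corollary1p3 (R : realType) (q delta : R)
    (hq : 1 < q) (hdelta0 : 0 < delta) (hdelta1 : delta < 1) :
  exists2 c : R, 0 < c &
    forall k : nat -> nat,
      (1 <= k 0)%N ->
      (forall j : nat, (k j < k j.+1)%N) ->
      (forall j : nat, q <= (k j.+1)%:R / (k j)%:R) ->
      forall N n : nat, (0 < N)%N -> n%:R <= (1 - delta) * N%:R ->
        (c%:E <= kolmogorov_width (@L1norm R) n (fun j : 'I_N => expT (k j)))%E.
Proof.
have [r r0 classes] := lacunary_residue_classes hq.
(* An integer [p >= 1 / delta] turns [n <= (1 - delta) * N] into [p * n + N <= p * N]. *)
pose p := (Num.truncn delta^-1).+1.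
have pdelta : 1 <= delta * p%:R by rewrite mulrC -ler_pdivrMr // mul1r ltW // truncnS_gt.
exists (8 * (2 ^ (14 * p))%:R * r%:R)^-1.
  by rewrite invr_gt0 !mulr_gt0 // ltr0n // expn_gt0.
move=> k k0 kS lac N n N0 nN.
have k_gt0 j : (0 < k j)%N by elim: j => // j /leq_trans; apply; apply: ltnW.
have lac' j : q * (k j)%:R <= (k j.+1)%:R by rewrite -ler_pdivlMr ?ltr0n.
apply: lacunary_width_ge => //; try by move=> a; have [] := classes k k0 lac' a.
rewrite -(ler_nat R) natrD !natrM.
have NR : 0 <= N%:R :> R by []; have pR : 0 <= p%:R :> R by [].
by have := ler_wpM2l pR nN; have := ler_wpM2r NR pdelta; lra.
Qed.
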